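(* Let $\mathcal{G}$ be a class of graphs that is contained in the class of $P_4$-extendible graphs or contained in the class of $P_4$-sparse graphs, and that is closed under taking complements and under taking induced subgraphs. Then any hereditary property $\mathcal{P}$ on the class $\mathcal{G}$ has (up to isomorphism) only a finite number of minimal $\mathcal{P}$-obstructions in $\mathcal{G}$.
   Context: All graphs are simple and finite; graph classes and properties are closed under isomorphism. A property $\mathcal{P}$ of graphs is hereditary if it is closed under taking induced subgraphs. A minimal $\mathcal{P}$-obstruction is a graph that does not have property $\mathcal{P}$ but all of whose proper induced subgraphs have property $\mathcal{P}$. ''A $P_4$'' of a graph means an induced path on four vertices. A graph is $P_4$-sparse if every set of five vertices induces at most one $P_4$. A graph is $P_4$-extendible if for every vertex subset $W$ inducing a $P_4$, there is at most one vertex $v\notin W$ that belongs to a $P_4$ sharing vertices with $W$. *)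

(* Defs.v *)
(* MathComp *)
From HB Require Import structures.
From mathcomp Require Import all_boot.

Set Implicit Arguments.
Unset Strict Implicit.
Unset Printing Implicit Defensive.

(* The graph without vertices is allowed. *)
Record sgraph := SGraph {
  vertex :> finType;
  edge : rel vertex;
  edge_sym : symmetric edge;
  edge_irr : irreflexive edge }.

Arguments edge {s} x y.

Definition iso (G H : sgraph) : Prop :=
  exists2 f : G -> H, bijective f & forall x y, edge (f x) (f y) = edge x y.

Section Induced.
Variables (G : sgraph) (A : {set G}).

Definition induced_edge : rel {x : G | x \in A} :=
  fun u v => edge (val u) (val v).

Lemma induced_edge_sym : symmetric induced_edge.
Proof. by move=> u v; rewrite /induced_edge edge_sym. Qed.

Lemma induced_edge_irr : irreflexive induced_edge.
Proof. by move=> u; rewrite /induced_edge edge_irr. Qed.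

Definition induced : sgraph := SGraph induced_edge_sym induced_edge_irr.
End Induced.

Section Complement.
Variable G : sgraph.

Definition compl_edge : rel G := fun x y => (x != y) && ~~ edge x y.

Lemma compl_edge_sym : symmetric compl_edge.
Proof. by move=> x y; rewrite /compl_edge eq_sym edge_sym. Qed.

Lemma compl_edge_irr : irreflexive compl_edge.
Proof. by move=> x; rewrite /compl_edge eqxx. Qed.

Definition compl : sgraph := SGraph compl_edge_sym compl_edge_irr.
End Complement.

Definition path_edge (n : nat) : rel 'I_n :=
  fun i j => (i.+1 == j :> nat) || (j.+1 == i :> nat).

Lemma path_edge_sym n : symmetric (@path_edge n).
Proof. by move=> i j; rewrite /path_edge orbC. Qed.

Lemma path_edge_irr n : irreflexive (@path_edge n).
Proof. by move=> i; rewrite /path_edge orbb gtn_eqF. Qed.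

Definition path_graph (n : nat) : sgraph :=
  SGraph (@path_edge_sym n) (@path_edge_irr n).

Definition is_P4 (G : sgraph) (W : {set G}) : Prop :=
  iso (induced W) (path_graph 4).

(* An induced P_4 is determined by its vertex set, so P_4's are counted as
   vertex sets. *)
Definition P4_sparse (G : sgraph) : Prop :=
  forall W : {set G}, #|W| = 5 ->
  forall S T : {set G}, S \subset W -> T \subset W ->
  is_P4 S -> is_P4 T -> S = T.

Definition in_P4_meeting (G : sgraph) (W : {set G}) (v : G) : Prop :=
  exists S : {set G}, [/\ is_P4 S, v \in S & S :&: W != set0].

Definition P4_extendible (G : sgraph) : Prop :=
  forall W : {set G}, is_P4 W ->
  forall u v : G, u \notin W -> v \notin W ->
  in_P4_meeting W u -> in_P4_meeting W v -> u = v.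

Definition iso_closed (C : sgraph -> Prop) : Prop :=
  forall G H : sgraph, iso G H -> C G -> C H.

Definition compl_closed (C : sgraph -> Prop) : Prop :=
  forall G : sgraph, C G -> C (compl G).

Definition induced_closed (C : sgraph -> Prop) : Prop :=
  forall (G : sgraph) (A : {set G}), C G -> C (induced A).

(* Nothing is required of P outside C. *)
Definition hereditary_on (C P : sgraph -> Prop) : Prop :=
  forall (G : sgraph) (A : {set G}), C G -> P G -> P (induced A).

Definition minimal_obstruction (P : sgraph -> Prop) (G : sgraph) : Prop :=
  ~ P G /\ forall A : {set G}, A \proper [set: G] -> P (induced A).

Definition finite_up_to_iso (C : sgraph -> Prop) : Prop :=
  exists (n : nat) (F : 'I_n -> sgraph),
  forall G : sgraph, C G -> exists i : 'I_n, iso G (F i).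

(* Main.v *)
(* Minimal obstructions form an antichain under induced subgraph embedding, so it
   suffices that the class is well-quasi-ordered. In a minimal bad sequence
   (Nash-Williams) the proper induced subgraphs of the members are
   well-quasi-ordered. Each member is disconnected, co-disconnected, or consists
   of a body and a head, all head vertices having the same neighbours in the
   body; the body is a spider or has at most five vertices. Bodies with their
   marked neighbourhood are well-quasi-ordered, hence so are the members: a
   contradiction.

   To get the decomposition, take a P_4 (Seinsche) and enlarge it to a body
   that a vertex outside sees not at all, completely, or exactly in its middle.
   The body and the vertices of the last kind form a module; contract it and
   use induction. A vertex of a P_4 has at most one twin, so the contracted vertex
   stays out of the new body. *)

Require Import Defs.
From Stdlib Require Import Classical IndefiniteDescription.
From mathcomp Require Import all_boot.

Set Implicit Arguments.
Unset Strict Implicit.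
Unset Printing Implicit Defensive.

Lemma ex_minimum (T : Type) (m : T -> nat) (P : T -> Prop) :
  (exists x, P x) -> exists2 x, P x & forall y, P y -> m x <= m y.
Proof.
case=> x; have [n] := ubnP (m x); elim: n x => // n IHn x lt_xn Px.
have [[y Py lt_yx]|min_x] := classic (exists2 y, P y & m y < m x).
  by apply: IHn Py; apply: leq_trans lt_yx _.
exists x => // y Py; rewrite leqNgt; apply/negP => lt_yx.
by case: min_x; exists y.
Qed.

(** * Well-quasi-orders *)

Definition wqo (T : Type) (R : T -> T -> Prop) (S : T -> Prop) : Prop :=
  forall f : nat -> T, (forall i, S (f i)) ->
  exists i j, i < j /\ R (f i) (f j).

Lemma unbounded_subsequence (P : nat -> Prop) :
  (forall n, exists2 i, n <= i & P i) ->
  exists2 h : nat -> nat, {homo h : i j / i < j} & forall n, P (h n).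
Proof.
move=> unb.
have /functional_choice [g g_prop] : forall n, exists i, n <= i /\ P i.
  by move=> n; have [i] := unb n; exists i.
pose h := fix h n := if n is m.+1 then g (h m).+1 else g 0.
exists h.
  by apply: homo_ltn => [y x z|i]; [apply: ltn_trans|case: (g_prop (h i).+1)].
by case=> [|n] /=; [case: (g_prop 0)|case: (g_prop (h n).+1)].
Qed.

(** If terms that lie below no later term occur arbitrarily far out, they form a bad sequence.
    Otherwise, from some index on, every term has a later one above it, and these jumps are
    iterated. *)
Lemma wqo_chain (T : Type) (R : T -> T -> Prop) (S : T -> Prop) (f : nat -> T) :
  (forall y x z, R x y -> R y z -> R x z) -> wqo R S -> (forall i, S (f i)) ->
  exists2 h : nat -> nat, {homo h : i j / i < j} &
    forall i j, i < j -> R (f (h i)) (f (h j)).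
Proof.
move=> R_trans wS Sf.
pose last i := forall j, i < j -> ~ R (f i) (f j).
have [/unbounded_subsequence [h h_inc h_last]|] :=
  classic (forall n, exists2 i, n <= i & last i).
  have [i [j [lt_ij Rij]]] := wS (fun i => f (h i)) (fun i => Sf (h i)).
  by case: (h_last i (h j)) => //; apply: h_inc.
move=> /not_all_ex_not [n no_last].
have /functional_choice [g g_prop] : forall i, exists j, n <= i -> i < j /\ R (f i) (f j).
  move=> i; have [le_ni|] := leqP n i; last by exists 0.
  apply: NNPP => no_j; apply: no_last; exists i => // j lt_ij Rij.
  by apply: no_j; exists j.
pose h := fix h m := if m is k.+1 then g (h k) else n.
have le_nh m : n <= h m.
  elim: m => //= m le_nh; have [lt_h _] := g_prop _ le_nh.
  exact: leq_trans le_nh (ltnW lt_h).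
exists h.
  by apply: homo_ltn => [y x z|i]; [apply: ltn_trans|case: (g_prop _ (le_nh i))].
move=> i j; apply: (@homo_ltn _ (fun i => f (h i)) R) => // k /=.
by case: (g_prop _ (le_nh k)).
Qed.

Lemma wqo_prod (T U : Type) (R : T -> T -> Prop) (R' : U -> U -> Prop)
    (S : T -> Prop) (S' : U -> Prop) :
  (forall y x z, R x y -> R y z -> R x z) -> wqo R S -> wqo R' S' ->
  wqo (fun p q => R p.1 q.1 /\ R' p.2 q.2) (fun p => S p.1 /\ S' p.2).
Proof.
move=> R_trans wS wS' f Sf.
have [h h_inc h_chain] :=
  wqo_chain (f := fun i => (f i).1) R_trans wS (fun i => proj1 (Sf i)).
have [i [j [lt_ij Rij]]] := wS' (fun i => (f (h i)).2) (fun i => proj2 (Sf (h i))).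
by exists (h i), (h j); split; [apply: h_inc|split; [apply: h_chain|]].
Qed.

Lemma wqo_union (T : Type) (R : T -> T -> Prop) (S S' : T -> Prop) :
  wqo R S -> wqo R S' -> wqo R (fun x => S x \/ S' x).
Proof.
move=> wS wS' f Sf.
have [/unbounded_subsequence [h h_inc Sh]|] :=
  classic (forall n, exists2 i, n <= i & S (f i)).
  have [i [j [lt_ij Rij]]] := wS (fun i => f (h i)) Sh.
  by exists (h i), (h j); split; first exact: h_inc.
move=> /not_all_ex_not [n noS].
have S'f i : S' (f (n + i)).
  case: (Sf (n + i)) => // Sni; case: noS.
  by exists (n + i); first exact: leq_addr.
have [i [j [lt_ij Rij]]] := wS' (fun i => f (n + i)) S'f.
by exists (n + i), (n + j); rewrite ltn_add2l.
Qed.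

(** [L] is a relation, not a function: a graph may have many codes, and any one of them will do. *)
Lemma wqo_link (T U : Type) (R : T -> T -> Prop) (S : T -> Prop)
    (R' : U -> U -> Prop) (S' : U -> Prop) (L : U -> T -> Prop) :
  wqo R S -> (forall u, S' u -> exists2 t, S t & L u t) ->
  (forall u u' t t', L u t -> L u' t' -> R t t' -> R' u u') -> wqo R' S'.
Proof.
move=> wS S'S LR f S'f.
have /functional_choice [g g_prop] : forall i, exists t, S t /\ L (f i) t.
  by move=> i; have [t] := S'S _ (S'f i); exists t.
have [i [j [lt_ij Rij]]] := wS g (fun i => proj1 (g_prop i)).
by exists i, j; split=> //; apply: LR Rij; [case: (g_prop i)|case: (g_prop j)].
Qed.

Lemma wqo_fin (T : finType) : wqo (@eq T) (fun=> True).
Proof.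
move=> f _; apply: NNPP => no_rep.
have f_inj : injective (fun i : 'I_#|T|.+1 => f i).
  move=> i j eq_f; apply: val_inj.
  by case: (ltngtP i j) => // lt_ij; case: no_rep; do 2!eexists; split; eauto.
by have := leq_card _ f_inj; rewrite card_ord ltnn.
Qed.

Lemma wqo_leq : wqo (fun m n => m <= n) (fun=> True).
Proof.
move=> f _; have [_ [i ->] min_i] := @ex_minimum _ id (fun k => exists i, k = f i)
  (ex_intro _ _ (ex_intro _ 0 erefl)).
by exists i, i.+1; split=> //; apply: min_i; exists i.+1.
Qed.

Definition bad (T : Type) (R : T -> T -> Prop) (S : T -> Prop) (f : nat -> T) :=
  (forall i, S (f i)) /\ (forall i j, i < j -> ~ R (f i) (f j)).

(** Entries are fixed one after the other: [t n] is a bad sequence that is final below [n], and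
    [step] makes entry [n] as small as possible among its bad continuations. The diagonal is the
    sequence sought. *)
Lemma minimal_bad_sequence (T : Type) (R : T -> T -> Prop) (S : T -> Prop)
    (m : T -> nat) (f : nat -> T) :
  bad R S f ->
  exists2 h, bad R S h &
    forall n g, bad R S g -> (forall i, i < n -> g i = h i) -> m (h n) <= m (g n).
Proof.
move=> bad_f.
have /functional_choice [step step_prop] : forall p : nat * (nat -> T), exists s,
    bad R S p.2 -> [/\ bad R S s, forall i, i < p.1 -> s i = p.2 i
    & forall g, bad R S g -> (forall i, i < p.1 -> g i = p.2 i) ->
        m (s p.1) <= m (g p.1)].
  case=> n s /=; have [bad_s|] := classic (bad R S s); last by exists s.
  have [|t [bad_t eq_ts] min_t] := @ex_minimum _ (fun t : nat -> T => m (t n))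
    (fun t => bad R S t /\ (forall i, i < n -> t i = s i)); first by exists s.
  by exists t => _; split=> // g bad_g eq_gs; apply: min_t.
pose t := fix t n := if n is k.+1 then step (k, t k) else f.
have bad_t n : bad R S (t n).
  by elim: n => //= n bad_tn; case: (step_prop (n, t n)).
have t_step n g : bad R S g -> (forall i, i < n -> g i = t n i) ->
    m (t n.+1 n) <= m (g n).
  by case: (step_prop (n, t n) (bad_t n)) => _ _ /(_ g).
have t_stable i n : i < n -> t n i = t i.+1 i.
  elim: n => // n IHn; rewrite ltnS leq_eqVlt => /predU1P [->//|lt_in].
  have [_ eq_t _] := step_prop (n, t n) (bad_t n).
  by rewrite -IHn //; apply: eq_t.
clearbody t.
exists (fun n => t n.+1 n).
  split=> [i|i j lt_ij]; first by case: (bad_t i.+1).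
  have [_ /(_ i j lt_ij)] := bad_t j.+1.
  by rewrite (t_stable i j.+1) // ltnS ltnW.
move=> n g bad_g eq_g; apply: t_step => // i lt_in.
by rewrite eq_g // -(t_stable i n lt_in).
Qed.

(* Nash-Williams: along a bad sequence minimizing the measure termwise, a bad
   sequence of parts could be spliced in to contradict minimality. *)
Lemma wqo_minimal_bad (T : Type) (R : T -> T -> Prop) (S : T -> Prop)
    (m : T -> nat) (part : T -> T -> Prop) :
  (forall a x y, R a x -> part x y -> R a y) ->
  (forall x y, part x y -> m x < m y) ->
  (forall x y, part x y -> S y -> S x) ->
  (forall Q, wqo R Q -> wqo R (fun y => S y /\ forall x, part x y -> Q x)) ->
  wqo R S.
Proof.
move=> R_part m_part S_part IH f Sf; apply: NNPP => no_good.
have /(minimal_bad_sequence m) [h [Sh bad_h] min_h] : bad R S f.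
  by split=> // i j lt_ij Rij; apply: no_good; exists i, j.
have /IH wqo_parts : wqo R (fun x => exists n, part x (h n)).
  move=> g /functional_choice [p g_part]; apply: NNPP => bad_g.
  (* Keep [h] before the least parent index [p k] and continue with [g] from [k] on. A kept entry
     then precedes the parent of every part used, so a relation from it to a part would carry over
     to that parent. *)
  have [_ [k ->] min_k] := @ex_minimum _ id (fun n => exists k, n = p k)
    (ex_intro _ _ (ex_intro _ 0 erefl)).
  pose s n := if n < p k then h n else g (n - p k + k).
  have bad_s : bad R S s.
    split=> [i|i j lt_ij]; rewrite /s.
      by case: ifP => // _; apply: S_part (g_part _) (Sh _).
    case: (ltnP j (p k)) => [lt_j|le_j].
      by rewrite (ltn_trans lt_ij lt_j); apply: bad_h.
    case: ltnP => [lt_i|le_i] Rij.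
      apply: (bad_h i (p (j - p k + k))); last exact: R_part Rij (g_part _).
      by apply: leq_trans lt_i _; apply: min_k; exists (j - p k + k).
    apply: bad_g; exists (i - p k + k), (j - p k + k); split=> //.
    by rewrite ltn_add2r ltn_sub2r // (leq_ltn_trans le_i).
  have /(min_h _ _ bad_s) : forall i, i < p k -> s i = h i by move=> i; rewrite /s => ->.
  by rewrite /s ltnn subnn add0n leqNgt m_part.
have [|i [j [lt_ij Rij]]] := wqo_parts h; last exact: bad_h Rij.
by move=> i; split=> // x part_x; exists i.
Qed.

(** * Embeddings *)

Definition embed (G H : sgraph) : Prop :=
  exists2 f : G -> H, injective f & forall x y, edge (f x) (f y) = edge x y.

(** The marks on a body record which of its vertices the head sees. *)
Definition marked := {G : sgraph & {set G}}.

Definition membed (X Y : marked) : Prop :=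
  exists f : tag X -> tag Y, [/\ injective f,
    forall x y, edge (f x) (f y) = edge x y &
    forall x, (f x \in tagged Y) = (x \in tagged X)].

Lemma embed_trans (H G K : sgraph) : embed G H -> embed H K -> embed G K.
Proof.
case=> f f_inj f_edge [g g_inj g_edge]; exists (g \o f); first exact: inj_comp.
by move=> x y /=; rewrite g_edge f_edge.
Qed.

Lemma membed_trans (Y X Z : marked) : membed X Y -> membed Y Z -> membed X Z.
Proof.
case=> f [f_inj f_edge f_mark] [g [g_inj g_edge g_mark]].
exists (g \o f); split; first exact: inj_comp.
  by move=> x y /=; rewrite g_edge f_edge.
by move=> x /=; rewrite g_mark f_mark.
Qed.

Lemma embed_induced (G : sgraph) (A : {set G}) : embed (induced A) G.
Proof. by exists val; first exact: val_inj. Qed.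

Definition induced_marked (G : sgraph) (D K : {set G}) : marked :=
  existT (fun H : sgraph => {set H}) (induced D) [set u | val u \in K].

(* [D] is the body and its complement the head of [G]: each head vertex is
   adjacent to exactly the vertices of [D] that lie in [K]. *)
Definition body_split (G : sgraph) (D K : {set G}) : Prop :=
  forall x y, x \in D -> y \notin D -> edge x y = (x \in K).

(** Bodies and heads are embedded separately. The two maps glue because adjacency between body and
    head depends only on the mark of the body vertex, and marks are preserved. *)
Lemma embed_body_split (G H : sgraph) (D K : {set G}) (D' K' : {set H}) :
  body_split D K -> body_split D' K' ->
  membed (induced_marked D K) (induced_marked D' K') ->
  embed (induced (~: D)) (induced (~: D')) -> embed G H.
Proof.
move=> splitD splitD' [f /= [f_inj f_edge f_mark]] [g g_inj g_edge].
have [h h_prop] : exists h : G -> H, forall x,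
    (forall u : induced D, val u = x -> h x = val (f u)) /\
    (forall w : induced (~: D), val w = x -> h x = val (g w)).
  apply: (fin_all_exists (P := fun x y =>
    (forall u : induced D, val u = x -> y = val (f u)) /\
    (forall w : induced (~: D), val w = x -> y = val (g w)))) => x.
  case: (boolP (x \in D)) => [xD|]; last rewrite -in_setC => xD.
    exists (val (f (exist _ x xD))); split=> [u eq_u|w eq_w].
      by congr (val (f _)); apply: val_inj.
    by have := valP w; rewrite eq_w in_setC xD.
  exists (val (g (exist _ x xD))); split=> [u eq_u|w eq_w].
    by exfalso; move: xD; rewrite in_setC -eq_u (valP u).
  by congr (val (g _)); apply: val_inj.
have hD u : h (val u) = val (f u) by case: (h_prop (val u)) => /(_ u erefl).
have hC w : h (val w) = val (g w) by case: (h_prop (val w)) => _ /(_ w erefl).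
have case_x x : (exists u : induced D, x = val u) \/
                (exists w : induced (~: D), x = val w).
  case: (boolP (x \in D)) => [xD|]; last rewrite -in_setC => xD.
    by left; exists (exist _ x xD).
  by right; exists (exist _ x xD).
have NC (F : sgraph) (B : {set F}) (w : induced (~: B)) : val w \notin B.
  by have := valP w; rewrite in_setC.
have cross (u : induced D) (w : induced (~: D)) :
    edge (h (val u)) (h (val w)) = edge (val u) (val w).
  rewrite hD hC splitD ?NC ?(valP u) // splitD' ?NC ?(valP (f u)) //.
  by have := f_mark u; rewrite !inE.
exists h.
  move=> x y; case: (case_x x) => [[u ->]|[u ->]];
    case: (case_x y) => [[w ->]|[w ->]]; rewrite ?hD ?hC.
  - by move/val_inj/f_inj ->.
  - by move=> eq_fg; have := NC _ _ (g w); rewrite -eq_fg (valP (f u)).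
  - by move=> eq_fg; have := NC _ _ (g u); rewrite eq_fg (valP (f w)).
  - by move/val_inj/g_inj ->.
move=> x y; case: (case_x x) => [[u ->]|[u ->]];
  case: (case_x y) => [[w ->]|[w ->]].
- by rewrite !hD; apply: f_edge.
- exact: cross.
- by rewrite edge_sym cross edge_sym.
- by rewrite !hC; apply: g_edge.
Qed.

(** A split codes the graph by its marked body and its head. The head is a proper induced subgraph
    since [D] is nonempty, so the minimal bad sequence argument takes care of it; so it does of a
    proper [D] with a constant marking. *)
Lemma wqo_embed_body (C : sgraph -> Prop) (body : marked -> Prop) :
  induced_closed C -> wqo membed body ->
  (forall G : sgraph, C G -> 0 < #|G| -> exists D K : {set G},
     [/\ D != set0, body_split D K &
         D != setT /\ (K = set0 \/ K = setT) \/ body (induced_marked D K)]) ->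
  wqo embed C.
Proof.
move=> C_induced wqo_body splits.
apply: (@wqo_minimal_bad _ _ _ (fun G : sgraph => #|G|)
  (fun H G => exists2 A : {set G}, A != setT & H = induced A)).
- by move=> F H G emb_FH [A _ eH]; apply: embed_trans emb_FH _; rewrite eH; apply: embed_induced.
- move=> _ G [A neqA ->]; rewrite /= card_sig -cardsT; apply: proper_card.
  by rewrite properT.
- by move=> _ G [A _ ->]; apply: C_induced.
move=> Q wqo_Q.
(* The empty graph admits no nonempty body and is treated apart. *)
have wqo_empty : wqo embed (fun G : sgraph => #|G| = 0).
  move=> f f0; exists 0, 1; split=> //.
  have no (x : f 0) : False by have := fintype0 x; apply; apply: f0.
  by exists (fun x => False_rect _ (no x)) => x; case: (no x).
have wqo_const (K : forall G : sgraph, {set G}) (b : bool) :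
    (forall (G : sgraph) x, (x \in K G) = b) ->
    wqo membed (fun X => Q (tag X) /\ tagged X = K (tag X)).
  move=> K_b; apply: (wqo_link (L := fun X G => tag X = G /\ tagged X = K (tag X)) wqo_Q).
    by move=> X [QX eK]; exists (tag X).
  move=> [G A] [H B] _ _ /= [<- ->] [<- ->] [f f_inj f_edge].
  by exists f; split=> // x /=; rewrite !K_b.
have wqo_marked := wqo_union wqo_body (wqo_union
  (wqo_const (fun=> set0) false (fun G => @in_set0 G))
  (wqo_const (fun=> setT) true (fun G => @in_setT G))).
have wqo_pair := wqo_prod (fun Y X Z => @membed_trans Y X Z) wqo_marked wqo_Q.
suff wqo_nonempty : wqo embed (fun G =>
    0 < #|G| /\ (C G /\ forall H, (exists2 A : {set G}, A != setT & H = induced A) -> Q H)).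
  apply: (wqo_link (L := eq) (wqo_union wqo_empty wqo_nonempty)) => [G CG|_ _ G H -> ->] //.
  by exists G => //; have [G0|nzG] := posnP #|G|; [left|right].
apply: (wqo_link (L := fun (G : sgraph) (p : marked * sgraph) =>
   exists D K : {set G}, [/\ body_split D K, p.1 = induced_marked D K & p.2 = induced (~: D)]) wqo_pair).
  move=> G [nzG [CG QG]]; have [D [K [nzD splitD bodyD]]] := splits G CG nzG.
  have neqC : ~: D != setT by rewrite -setC0 (inj_eq (@setC_inj G)).
  exists (induced_marked D K, induced (~: D)); last by exists D, K.
  split; last by apply: QG; exists (~: D).
  case: bodyD => [[neqD [->|->]]|]; last by left.
    right; left; split; first by apply: QG; exists D.
    by apply/setP=> u; rewrite !inE.
  right; right; split; first by apply: QG; exists D.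
  by apply/setP=> u; rewrite !inE.
move=> G H [X G'] [Y H'] [D [K [splitD /= -> ->]]] [D' [K' [splitD' -> ->]]] [].
exact: embed_body_split.
Qed.

(** * Bodies of bounded size and spiders *)

(** A copy of the graph inside ['I_n], recorded by its vertex, edge and marked sets, is one of
    finitely many codes; equal codes force an isomorphism. *)
Lemma wqo_bounded_size n : wqo membed (fun X => #|tag X| <= n).
Proof.
pose codes (X : marked) (c : {set 'I_n} * {set 'I_n * 'I_n} * {set 'I_n}) :=
  exists f : tag X -> 'I_n, [/\ injective f,
    c.1.1 = f @: setT,
    forall x y, ((f x, f y) \in c.1.2) = edge x y &
    forall x, (f x \in c.2) = (x \in tagged X)].
apply: (wqo_link (L := codes) (@wqo_fin _)) =>
  [X leX|X Y c c' [f [f_inj fV fE fK]] [g []] + + + + eq_c].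
  have [f f_inj] : exists f : tag X -> 'I_n, injective f.
    exists (fun x => widen_ord leX (enum_rank x)) => x y /(congr1 val) /=.
    by move=> /val_inj /enum_rank_inj.
  exists (f @: setT, [set (f p.1, f p.2) | p in [set p | edge p.1 p.2]], f @: tagged X) => //.
  exists f; split=> //= [x y|x]; last by rewrite mem_imset.
  apply/imsetP/idP => [[[x' y'] + [eq_x eq_y]]|exy].
    by rewrite inE (f_inj _ _ eq_x) (f_inj _ _ eq_y).
  by exists (x, y); rewrite ?inE.
rewrite -{c'}eq_c => g_inj gV gE gK.
have [h gh] : exists h : tag X -> tag Y, forall x, g (h x) = f x.
  apply: (fin_all_exists (P := fun x y => g y = f x)) => x.
  have /imsetP [y _ eq_y] : f x \in g @: setT by rewrite -gV fV imset_f.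
  by exists y.
exists h; split=> [x y /(congr1 g)|x y|x]; first by rewrite !gh => /f_inj.
  by rewrite -gE !gh fE.
by rewrite -gK gh fK.
Qed.

(** Across the sides this is a perfect matching in a thin spider and its complement in a thick
    one. *)
Definition spider_edge (thick b b' : bool) (i j : nat) : bool :=
  if b (+) b' then (i == j) (+) thick else b && (i != j).

(* [g true] enumerates the clique and [g false] the independent set. *)
Definition spider (T : Type) (e : rel T) (thick : bool) (n : nat)
    (g : bool -> nat -> T) : Prop :=
  forall b b' i j, i < n -> j < n -> e (g b i) (g b' j) = spider_edge thick b b' i j.

(** Coinciding vertices have the same neighbours. A clique vertex sees some leg, by [1 < n] even in
    a thick spider, whereas a leg sees no leg; within one side, the adjacencies to the other side
    reveal the index. *)
Lemma spider_inj (T : Type) (e : rel T) thick n (g : bool -> nat -> T) b b' i j :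
  1 < n -> spider e thick n g -> i < n -> j < n ->
  g b i = g b' j -> b = b' /\ i = j.
Proof.
move=> n_gt1 sp lt_i lt_j eq_g.
have eq_e b'' l : l < n -> spider_edge thick b b'' i l = spider_edge thick b' b'' j l.
  by move=> lt_l; rewrite -!sp // eq_g.
have eb : b = b'.
  have [l lt_l neq_l] : exists2 l, l < n & l != i.
    by case: (i =P 0) => [->|/eqP nz]; [exists 1|exists 0; rewrite 1?eq_sym // ltnW].
  have [l' lt_l' eq_l'] : exists2 l, l < n & (l == j) (+) thick.
    case: (thick); last by exists j; rewrite ?eqxx.
    by case: (j =P 0) => [->|/eqP nz]; [exists 1|exists 0; rewrite ?addbT 1?eq_sym // ltnW].
  have [l'' lt_l'' eq_l''] : exists2 l, l < n & (l == i) (+) thick.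
    case: (thick); last by exists i; rewrite ?eqxx.
    by case: (i =P 0) => [->|/eqP nz]; [exists 1|exists 0; rewrite ?addbT 1?eq_sym // ltnW].
  move: eq_e eq_l' eq_l''; rewrite (eq_sym _ i) (eq_sym _ j) /spider_edge.
  case: b b' {eq_g} => [] [] //= eq_e.
    by move=> _; have := eq_e false _ lt_l''; rewrite /= => ->.
  by have := eq_e false _ lt_l'; rewrite /= => <-.
split=> //; subst b'; apply/eqP.
have := eq_e (~~ b) i lt_i; have := eq_e (~~ b) j lt_j.
by rewrite /spider_edge addbN addbb /= !eqxx (eq_sym j) => + _; case: (i == j) (thick) => [] [].
Qed.

Definition marked_spider (X : marked) : Prop :=
  exists thick n g, [/\ 1 < n, spider (@edge (tag X)) thick n g,
    forall x, exists b i, i < n /\ g b i = x &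
    forall b i, i < n -> (g b i \in tagged X) = b].

(** Thickness and number of legs determine a marked spider, and dropping legs with their clique
    partners preserves the thickness. *)
Lemma wqo_spider : wqo membed marked_spider.
Proof.
have bool_trans (y x z : bool) : x = y -> y = z -> x = z by move=> ->.
have wqo_pair := wqo_prod bool_trans (@wqo_fin bool) wqo_leq.
pose L (X : marked) (p : bool * nat) := exists g,
  [/\ 1 < p.2, spider (@edge (tag X)) p.1 p.2 g,
    forall x, exists b i, i < p.2 /\ g b i = x &
    forall b i, i < p.2 -> (g b i \in tagged X) = b].
apply: (wqo_link (L := L) wqo_pair).
  by move=> X [thick [n [g gX]]]; exists (thick, n) => //; exists g.
move=> X Y [thick n] [thick' n'] [g /= [n_gt1 sp onto mark]].
move=> [g' /= [n'_gt1 sp' _ mark']] [eq_t le_n]; rewrite -{thick'}eq_t in sp'.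
have [h hE] : exists h : tag X -> bool * nat, forall x, (h x).2 < n /\ g (h x).1 (h x).2 = x.
  apply: (fin_all_exists (P := fun x p => p.2 < n /\ g p.1 p.2 = x)) => x.
  by have [b [i ?]] := onto x; exists (b, i).
have gh x : g (h x).1 (h x).2 = x by case: (hE x).
have lt_h x : (h x).2 < n by case: (hE x).
have lt_h' x : (h x).2 < n' by apply: leq_trans (lt_h x) le_n.
exists (fun x => g' (h x).1 (h x).2); split.
- move=> x y /(spider_inj n'_gt1 sp') [] // eq1 eq2.
  by rewrite -(gh x) -(gh y) eq1 eq2.
- by move=> x y; rewrite sp' // -[in RHS](gh x) -[in RHS](gh y) sp.
- by move=> x; rewrite mark' // -[in RHS](gh x) mark.
Qed.

(** * Induced paths on four vertices *)

Definition p4 (G : sgraph) (q : seq G) : bool :=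
  if q is [:: a; b; c; d] then
    [&& edge a b, edge b c, edge c d, ~~ edge a c, ~~ edge b d & ~~ edge a d]
  else false.

(* A vertex outside a P_4 creates no further P_4 with three of its vertices
   only if it is adjacent to none, to all, or exactly to the two midpoints. *)
Definition p4_trace (T : Type) (g : T -> bool) (q : seq T) : bool :=
  if q is [:: a; b; c; d] then [&& g a == g d, g b == g c & g a ==> g b]
  else false.

Lemma p4_uniq (G : sgraph) (q : seq G) : p4 q -> uniq q.
Proof.
case: q => [|a [|b [|c [|d []]]]] //= /and5P [ab bc cd nac /andP [nbd nad]].
rewrite /= !inE; apply/and4P; split; rewrite ?andbT ?negb_or //.
- apply/and3P; split; apply/eqP => eq_v; subst.
  + by rewrite edge_irr in ab.
  + by rewrite cd in nad.
  + by rewrite edge_sym cd in nac.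
- apply/andP; split; apply/eqP => eq_v; subst; first by rewrite edge_irr in bc.
  by rewrite ab in nad.
- by apply/eqP => eq_v; subst; rewrite edge_irr in cd.
Qed.

Lemma is_P4_p4 (G : sgraph) (q : seq G) : p4 q -> is_P4 [set x in q].
Proof.
move=> p4q; have q_uniq := p4_uniq p4q.
pose f (u : induced [set x in q]) : 'I_4 := inord (index (val u) q).
have size_q : size q = 4 by case: q p4q {q_uniq f} => [|a [|b [|c [|d []]]]].
have fE u : f u = index (val u) q :> nat.
  rewrite inordK // -[leqRHS]size_q index_mem.
  by have := valP u; rewrite inE.
have f_inj : injective f.
  move=> u w /(congr1 val) /=; rewrite !fE => eq_uw; apply: val_inj.
  have [uq wq] : val u \in q /\ val w \in q.
    by have := valP u; have := valP w; rewrite !inE.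
  by rewrite -(nth_index (val u) uq) eq_uw nth_index.
exists f.
  apply: inj_card_bij => //.
  by rewrite card_ord card_sig cardsE (card_uniqP q_uniq) size_q.
move=> u w; rewrite /edge /= /path_edge !fE /induced_edge.
have := valP w; have := valP u; rewrite !inE.
move: (val u) (val w) => x y {u w f_inj fE f size_q}.
case: q p4q q_uniq => [|a [|b [|c [|d []]]]] //= /and5P [ab bc cd].
move=> /negbTE nac /andP [/negbTE nbd /negbTE nad]; rewrite !inE !andbT !negb_or.
case/and3P=> /and3P [/negbTE nab /negbTE nac' /negbTE nad'].
case/andP=> /negbTE nbc /negbTE nbd' /negbTE ncd.
have E := (eqxx, nab, nac', nad', nbc, nbd', ncd, ab, bc, cd, nac, nbd, nad).
by case/or4P=> /eqP ->; case/or4P=> /eqP ->;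
  rewrite ?edge_irr ?E 1?[a == _]eq_sym 1?[b == _]eq_sym 1?[c == _]eq_sym
    ?E 1?edge_sym ?E.
Qed.

Lemma p4_extension (G : sgraph) (q : seq G) (x : G) :
  p4 q -> x \notin q -> ~~ p4_trace (edge x) q ->
  exists q', [/\ p4 q', x \in q', has (mem q) q' & {subset q' <= x :: q}].
Proof.
case: q => [|a [|b [|c [|d []]]]] //= /and5P [ab bc cd].
move=> /negbTE nac /andP [/negbTE nbd /negbTE nad] _.
have E := (ab, bc, cd, nac, nbd, nad).
have E' : (edge b a = true) * (edge c b = true) * (edge d c = true) *
  (edge c a = false) * (edge d b = false) * (edge d a = false).
  by rewrite (edge_sym b a) (edge_sym c b) (edge_sym d c) (edge_sym c a)
    (edge_sym d b) (edge_sym d a) !E.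
have Ex := (edge_sym a x, edge_sym b x, edge_sym c x, edge_sym d x).
(* Each candidate consists of [x] and three vertices of [q]; inspection of the sixteen traces shows
   that every forbidden one makes some candidate an induced path. *)
pose candidates := [:: [:: x; a; b; c]; [:: x; d; c; b]; [:: x; b; c; d];
  [:: x; c; b; a]; [:: d; c; x; a]; [:: a; b; x; d]; [:: c; d; x; a]; [:: b; a; x; d]].
have cand q' : q' \in candidates -> [&& x \in q', has (mem [:: a; b; c; d]) q'
    & all (mem [:: x; a; b; c; d]) q'].
  by move: q'; apply/allP; rewrite /= !inE !eqxx ?orbT.
move=> bad_trace; have /hasP [q' /cand /and3P [xq' meet /allP sub] p4q'] : has (@p4 G) candidates.
  move: bad_trace; rewrite /= !Ex !E !E'.
  by case: (edge x a) (edge x b) (edge x c) (edge x d) => [] [] [] [].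
by exists q'.
Qed.

Lemma compl_edgeE (G : sgraph) (x y : G) :
  @edge (compl G) x y = (x != y) && ~~ edge x y.
Proof. by []. Qed.

Lemma compl_p4 (G : sgraph) (a b c d : G) :
  @p4 (compl G) [:: a; b; c; d] -> p4 [:: b; d; a; c].
Proof.
move=> p4q; have : uniq ([:: a; b; c; d] : seq G) := p4_uniq p4q.
move: p4q.
rewrite /p4 !compl_edgeE /uniq !inE !negb_or andbT => +
  /and4P [/and3P [nab nac nad] /andP [nbc nbd] ncd _].
rewrite nab nac nad nbc nbd ncd /=; case/and5P=> ab bc cd; rewrite !negbK => ac /andP [bd ad].
by rewrite (edge_sym d a) (edge_sym b a) (edge_sym d c) ac bd ad ab bc cd.
Qed.

Definition has_p4 (G : sgraph) (A : {set G}) : Prop :=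
  exists2 q : seq G, p4 q & {subset q <= A}.

Lemma has_p4_compl (G : sgraph) (A : {set G}) :
  @has_p4 (compl G) A -> has_p4 A.
Proof.
case=> -[|a [|b [|c [|d []]]]] // /compl_p4 p4q sub; exists [:: b; d; a; c] => //.
by move=> z zq; apply: sub; move: zq; rewrite !inE => /or4P [] ->; rewrite ?orbT.
Qed.

(** * Decompositions *)

(** The value [b] covers disconnected (false) and co-disconnected (true) sets at once;
    complementation exchanges the two. *)
Definition const_split (G : sgraph) (A D : {set G}) (b : bool) : Prop :=
  [/\ D != set0, D \proper A &
      forall x y, x \in D -> y \in A :\: D -> edge x y = b].

Lemma const_split_compl (G : sgraph) (A D : {set G}) b :
  const_split A D b <-> @const_split (compl G) A D (~~ b).
Proof.
have neq x y : x \in D -> y \in A :\: D -> x != y.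
  by rewrite inE => xD /andP [+ _]; apply: contraNneq => <-.
split=> -[nzD ltD eD]; split=> // x y xD yD.
  by rewrite compl_edgeE neq // eD.
by have := eD x y xD yD; rewrite compl_edgeE neq //= => /negb_inj.
Qed.

Lemma no_const_split (G : sgraph) (A D : {set G}) b :
  ~ (exists D b, const_split A D b) -> D != set0 -> D \proper A ->
  exists x y, [/\ x \in D, y \in A :\: D & edge x y = ~~ b].
Proof.
move=> no_split nzD ltD; apply: NNPP => no_xy; apply: no_split.
exists D, b; split=> // x y xD yD; apply/eqP; apply: contra_notT no_xy => neq_b.
by exists x, y; split=> //; case: (edge x y) b neq_b => [] [].
Qed.

(** If [A] has no split, then [x] has a non-neighbour on one side of [A :\ x] and a neighbour on the
    other, and the first side contains an edge from a non-neighbour to a neighbour of [x]. *)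
Lemma p4_of_disconnected (G : sgraph) (A D : {set G}) (x : G) :
  x \in A -> const_split (A :\ x) D false ->
  (exists D b, const_split A D b) \/ has_p4 A.
Proof.
move=> xA splitD; have [|no_split] := classic (exists D b, const_split A D b); [by left|right].
(* Since [[set x]] is no split with value true, [x] has a non-neighbour; the side containing it is
   named [D]. *)
wlog [y [yD nxy]] : D splitD / exists y, y \in D /\ edge x y = false.
  have {splitD} [nzD ltD eD] := splitD.
  have ltx : [set x] \proper A.
    rewrite properEneq sub1set xA andbT; apply: contraNneq nzD => eqA.
    have := proper_sub ltD; rewrite -eqA setDv subset0 => /eqP ->.
    by rewrite eqxx.
  have [|x' [y [/set1P -> yA nxy]]] := no_const_split true no_split _ ltx.
    by apply/set0Pn; exists x; rewrite inE.
  move=> wlog_y; have [yD|yD] := boolP (y \in D); first by apply: (wlog_y D) => //; exists y.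
  apply: (wlog_y ((A :\ x) :\: D)); last by exists y; rewrite inE yD.
  split.
  - by apply/set0Pn; exists y; rewrite inE yD.
  - rewrite properE subsetDl; have /set0Pn [z zD] := nzD.
    apply/subsetPn; exists z; first exact: (subsetP (proper_sub ltD)).
    by rewrite inE zD.
  - move=> u w uE wD; rewrite edge_sym; apply: eD => //.
    by move: wD; rewrite !inE => /andP [+ wA]; rewrite wA andbT negbK.
have {splitD} [nzD ltD eD] := splitD.
have subD z : z \in D -> z \in A /\ z != x.
  by move/(subsetP (proper_sub ltD)); rewrite !inE => /andP [].
have outD z w : z \in D -> w \in A -> w \notin D -> edge z w -> w = x.
  move=> zD wA wD zw; apply/eqP; apply: contraTT zw => wx.
  by rewrite eD // !inE wx wA wD.
have xD : x \notin D by apply/negP => /subD []; rewrite eqxx.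
(* The other side [E] must be joined to the rest of [A], which only [x] can do. *)
have [z [zA zD xz]] : exists z, [/\ z \in A, z \notin D & edge x z].
  pose E := (A :\ x) :\: D.
  have nzE : E != set0.
    have [_ [z zA zD]] := properP ltD.
    by apply/set0Pn; exists z; rewrite inE zD.
  have ltE : E \proper A.
    rewrite properE (subset_trans (subsetDl _ _)) ?subD1set //.
    by apply/subsetPn; exists x; rewrite // !inE eqxx andbF.
  have [z [w [zE wE zw]]] := no_const_split false no_split nzE ltE.
  move: zE wE; rewrite !inE negb_and negbK => /and3P [zD zx zA].
  case: (boolP (w \in D)) => [wD|wD] /=.
    by move=> _; move: zw; rewrite edge_sym eD // !inE zD zx.
  case: (w =P x) => [eq_w _|/eqP wx /=]; last by case: (w \in A).
  by exists z; rewrite edge_sym -eq_w.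
(* [u] and [w] lie on the side of [y] and only [w] sees [x], so [u w x z] is a P_4. *)
have [||u [w [uD0 wA uw]]] := @no_const_split G A [set v in D | ~~ edge x v] false no_split.
- by apply/set0Pn; exists y; rewrite inE yD nxy.
- rewrite properE; apply/andP; split.
    by apply/subsetP=> v; rewrite inE => /andP [/subD []].
  by apply/subsetPn; exists x => //; rewrite inE (negbTE xD).
move: uD0 wA; rewrite !inE => /andP [uD nxu] /andP [wD0 wA].
have neq_wx : w != x.
  by apply: contraNneq nxu => <-; rewrite edge_sym uw.
have wD : w \in D.
  by apply: contraNT neq_wx => wD; rewrite (outD u w).
have xw : edge x w by move: wD0; rewrite wD negbK.
have zx : z != x by apply: contraTneq xz => ->; rewrite edge_irr.
exists [:: u; w; x; z].
  rewrite /= uw (edge_sym w x) xw xz (edge_sym u x) nxu !eD //= !inE zD zx //.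
by apply/allP; rewrite /= (proj1 (subD _ uD)) (proj1 (subD _ wD)) xA zA.
Qed.

(* Seinsche's theorem. *)
Lemma const_split_or_p4 (G : sgraph) (A : {set G}) :
  1 < #|A| -> (exists D b, const_split A D b) \/ has_p4 A.
Proof.
have [n] := ubnP #|A|; elim: n A => // n IHn A ltAn A_gt1.
have [x xA] : exists x, x \in A by apply/set0Pn; rewrite -card_gt0 ltnW.
have cardA : #|A| = #|A :\ x|.+1 by rewrite (cardsD1 x) xA.
have [A'_gt1|] := ltnP 1 #|A :\ x|; last first.
  rewrite leq_eqVlt ltnS leqn0 => /orP [/cards1P [y eqA]|/eqP A'0]; last first.
    by rewrite cardA A'0 in A_gt1.
  left; exists [set x], (edge x y); split.
  - by apply/set0Pn; exists x; rewrite inE.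
  - rewrite properE sub1set xA; apply/subsetPn; exists y; rewrite ?inE.
      by have := set11 y; rewrite -eqA inE => /andP [].
    by have := set11 y; rewrite -eqA !inE => /andP [].
  - by move=> x' y' /set1P ->; rewrite eqA => /set1P ->.
have lt'n : #|A :\ x| < n by rewrite -ltnS -cardA.
have [[D [[] splitD]]|[q p4q sub]] := IHn _ lt'n A'_gt1; first last.
- by right; exists q => // z /sub; rewrite inE => /andP [].
- exact: p4_of_disconnected xA splitD.
(* A split with value true has value false in the complement, and P_4 is self-complementary. *)
have [[D' [b splitD']]|] := @p4_of_disconnected (compl G) A D x xA
  (proj1 (const_split_compl _ _ _) splitD).
  by left; exists D', (~~ b); apply/const_split_compl; rewrite negbK.
by right; apply: has_p4_compl.
Qed.

(** This serves to keep the contracted vertex out of the body. The P_4 may leave [D]. *)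
Definition covered (G : sgraph) (A D : {set G}) : Prop :=
  forall z, z \in D -> exists q : seq G, [/\ p4 q, z \in q & {subset q <= A}].

Definition body_split_in (G : sgraph) (A D K : {set G}) : Prop :=
  forall x y, x \in D -> y \in A :\: D -> edge x y = (x \in K).

(* [Z] is a module of [A] consisting of the body [D] and its head. *)
Definition body_module (G : sgraph) (body : {set G} -> {set G} -> Prop)
    (A : {set G}) : Prop :=
  exists D K Z : {set G},
    [/\ D != set0, D \subset Z, Z \subset A, 2 < #|Z| &
    [/\ covered A D, body D K, body_split_in Z D K &
        forall x x' y, x \in Z -> x' \in Z -> y \in A :\: Z -> edge x y = edge x' y]].

(** An end of a P_4 sees exactly one midpoint, and a midpoint exactly one end. The twin inherits
    this, while a permitted trace is symmetric. *)
Lemma twin_not_p4_trace (G : sgraph) (q : seq G) (z z' : G) :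
  p4 q -> z \in q -> (forall u, u \in q -> u != z -> edge z' u = edge z u) ->
  ~~ p4_trace (edge z') q.
Proof.
move=> p4q zq twin; have := p4_uniq p4q.
case: q p4q zq twin => [|a [|b [|c [|d []]]]] //= /and5P [ab bc cd nac /andP [nbd nad]].
rewrite !inE => zq twin; rewrite !negb_or andbT.
case/and3P=> /and3P [nab' nac' nad'] /andP [nbc' nbd'] ncd'.
have tw u : [|| u == a, u == b, u == c | u == d] -> (u != z) || (z != u) ->
    edge u z' = edge u z.
  by move=> uq uz; rewrite edge_sym twin ?inE 1?edge_sym // -[_ != _]orbb {1}eq_sym orbC.
apply/negP => /and3P [/eqP + /eqP + /implyP]; rewrite !(edge_sym z').
case/or4P: zq => /eqP eq_z; subst z.
- by rewrite !(tw b, tw c, tw d) ?eqxx ?nab' ?nac' ?nad' ?orbT // !(edge_sym _ a) ab (negbTE nac).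
- rewrite (tw a) ?(tw d) ?(tw c) ?eqxx ?nab' ?nbc' ?nbd' ?orbT //.
  by rewrite ab (edge_sym d) (negbTE nbd).
- rewrite (tw a) ?(tw d) ?(tw b) ?eqxx ?nac' ?nbc' ?ncd' ?orbT //.
  by rewrite (edge_sym d) cd (negbTE nac).
- rewrite (tw a) ?(tw c) ?(tw b) ?eqxx ?nad' ?nbd' ?ncd' ?orbT //.
  by rewrite cd (negbTE nbd).
Qed.

Lemma split_or_body (G : sgraph) (body : {set G} -> {set G} -> Prop) :
  (forall (q : seq G) x y, p4 q -> x \notin q -> y \notin q -> x != y ->
     p4_trace (edge x) q \/ p4_trace (edge y) q) ->
  (forall A : {set G}, has_p4 A -> body_module body A) ->
  forall A : {set G}, 1 < #|A| -> (exists D b, const_split A D b) \/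
    exists D K : {set G},
      [/\ D != set0, D \subset A, covered A D, body D K & body_split_in A D K].
Proof.
move=> no_twins p4_body A; have [n] := ubnP #|A|; elim: n A => // n IHn A ltAn A_gt1.
have [|p4A] := const_split_or_p4 A_gt1; first by left.
have [D [K [Z [nzD sDZ sZA Z_gt2 [covD bodyD splitD modZ]]]]] := p4_body A p4A.
have [eqZ|neqZ] := eqVneq Z A; first by right; exists D, K; split; rewrite // -eqZ.
have [z zD] := set0Pn _ nzD; have zZ := subsetP sDZ z zD.
pose A' := z |: (A :\: Z).
have [w wA wZ] : exists2 w, w \in A & w \notin Z.
  by apply/subsetPn; apply: contra neqZ => sAZ; rewrite eqEsubset sZA.
have A'P u : reflect (u = z \/ u \in A /\ u \notin Z) (u \in A').
  rewrite !inE; apply: (iffP predU1P) => -[->|]; [by left| |by left|].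
    by case/andP=> uZ uA; right.
  by case=> -> ->; right.
have sA'A u : u \in A' -> u \in A.
  by case/A'P => [->|[]//]; apply: (subsetP sZA).
have zA' : z \in A' by apply/A'P; left.
have A'Z u : u \in A' -> u != z -> u \in A :\: Z.
  by case/A'P => [->|[uA uZ]]; rewrite ?eqxx // !inE uA uZ.
have ltA' : #|A'| < n.
  apply: leq_trans (_ : #|A| <= n); last by rewrite -ltnS.
  have Az : #|Z| + #|A :\: Z| = #|A| by rewrite -(cardsID Z A) (setIidPr sZA).
  rewrite cardsU1 -Az -addSn leq_add2r.
  by apply: leq_trans Z_gt2; rewrite ltnS; case: (_ \notin _).
have A'_gt1 : 1 < #|A'|.
  apply/card_gt1P; exists z, w; split=> //; first by apply/A'P; right.
  by apply: contraNneq wZ => <-.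
(* A decomposition of the contracted graph lifts by putting [Z] back for [z]. *)
case: (IHn A' ltA' A'_gt1) => [[D' [b [nzD' ltD' eD']]]|].
  left; have sD'A' := proper_sub ltD'.
  exists [set u in A | if u \in Z then z \in D' else u \in D'], b; split.
  - have [u uD'] := set0Pn _ nzD'; apply/set0Pn; exists u.
    have uA' := subsetP sD'A' u uD'; rewrite inE sA'A //.
    by case/A'P: uA' uD' => [->|[_ /negbTE ->]] //; rewrite zZ.
  - rewrite properE; apply/andP; split; first by apply/subsetP=> u /setIdP [].
    have [_ [u uA' uD']] := properP ltD'.
    apply/subsetPn; exists u; rewrite ?inE ?sA'A //=.
    by case/A'P: uA' uD' => [->|[_ /negbTE ->]] //; rewrite zZ.
  move=> u y; rewrite !inE => /andP [uA uD'] /andP [+ yA]; rewrite yA /= => yD'.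
  have inA' v : v \in A -> v \notin Z -> v \in A' by move=> vA vZ; apply/A'P; right.
  case: (boolP (u \in Z)) uD' => uZ uD'; case: (boolP (y \in Z)) yD' => yZ yD'.
  + by rewrite uD' in yD'.
  + by rewrite (modZ u z) ?eD' // in_setD ?yZ // yD' inA'.
  + by rewrite edge_sym (modZ y z) ?in_setD ?uZ // edge_sym eD' // in_setD yD' zA'.
  + by rewrite eD' // in_setD yD' inA'.
case=> D' [K' [nzD' sD'A' covD' bodyD' splitD']].
(* Otherwise [z] lies on a P_4 inside [A'], and every other vertex of [Z] is a twin of [z] with a
   forbidden trace. At least two such vertices exist. *)
have zD' : z \notin D'.
  apply/negP => /covD' [q [p4q zq sqA']].
  have twin z' : z' \in Z -> z' != z -> z' \notin q /\ ~~ p4_trace (edge z') q.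
    move=> z'Z neq_z'; split.
      by apply/negP => /sqA' /A'Z /(_ neq_z'); rewrite inE z'Z.
    apply: (twin_not_p4_trace p4q zq) => u /sqA' /A'Z uA /uA /modZ.
    by apply.
  have [z1 [z2 [z1Z z2Z neq12 neq1 neq2]]] : exists z1 z2,
      [/\ z1 \in Z, z2 \in Z, z1 != z2, z1 != z & z2 != z].
    have /card_gt1P [z1 [z2 []]] : 1 < #|Z :\ z| by rewrite (cardsD1 z) zZ in Z_gt2.
    by rewrite !inE => /andP [? ?] /andP [? ?] ?; exists z1, z2.
  have [nz1q /negP ntr1] := twin _ z1Z neq1.
  have [nz2q /negP ntr2] := twin _ z2Z neq2.
  by case: (no_twins q z1 z2).
right; exists D', K'; split=> //.
- by apply/subsetP=> u /(subsetP sD'A') /sA'A.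
- move=> u /covD' [q [p4q uq sqA']]; exists q; split=> // v /sqA' /sA'A //.
move=> u y uD'; rewrite inE => /andP [yD' yA].
have uA' := subsetP sD'A' u uD'.
have neq_uz : u != z by apply: contraNneq zD' => <-.
have [yZ|yZ] := boolP (y \in Z).
  rewrite edge_sym (modZ y z) ?A'Z // edge_sym.
  by apply: splitD'; rewrite // in_setD zD' zA'.
by apply: splitD'; rewrite // in_setD yD'; apply/A'P; right.
Qed.

(** * P_4-sparse graphs *)

Definition no_p4_extension (G : sgraph) : Prop :=
  forall (q : seq G) x, p4 q -> x \notin q -> p4_trace (edge x) q.

Definition spider_in (G : sgraph) (A : {set G}) thick n (g : bool -> nat -> G) :=
  [/\ 1 < n, spider (@edge G) thick n g & forall b i, i < n -> g b i \in A].

Definition spider_body (G : sgraph) (D K : {set G}) : Prop :=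
  exists thick n g, [/\ 1 < n, spider (@edge G) thick n g,
    forall x, x \in D <-> exists b i, i < n /\ g b i = x &
    forall b i, i < n -> (g b i \in K) = b].

(** Otherwise [x] and [q] form five vertices that carry a second P_4, through [x]. *)
Lemma P4_sparse_no_p4_extension (G : sgraph) : P4_sparse G -> no_p4_extension G.
Proof.
move=> sparse q x p4q xq; apply/negPn/negP => /(p4_extension p4q xq).
case=> q' [p4q' xq' _ sub].
have size_q : size q = 4 by case: q p4q {xq sub} => [|a [|b [|c [|d []]]]].
have cardW : #|[set z in x :: q]| = 5.
  have /card_uniqP : uniq (x :: q) by rewrite /= xq p4_uniq.
  by rewrite cardsE => ->; rewrite /= size_q.
suff eqS : [set z in q'] = [set z in q].
  by have := xq; rewrite -[x \in q]in_set -eqS inE xq'.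
apply: (sparse _ cardW); try exact: is_P4_p4.
  by apply/subsetP=> z; rewrite !inE => /sub; rewrite inE.
by apply/subsetP=> z; rewrite !inE => ->; rewrite orbT.
Qed.

(** Complementation exchanges ends with midpoints and seen with unseen. It swaps the empty and the
    full trace and fixes the one consisting of the midpoints. *)
Lemma no_p4_extension_compl (G : sgraph) :
  no_p4_extension G -> no_p4_extension (compl G).
Proof.
move=> tr q x p4q xq.
case: q p4q xq => [|a [|b [|c [|d []]]]] // /compl_p4 p4q xq.
have xq' : x \notin ([:: b; d; a; c] : seq G).
  by apply: contra xq; rewrite !inE => /or4P [] ->; rewrite ?orbT.
have := tr _ _ p4q xq'; move: xq'; rewrite /p4_trace !compl_edgeE.
rewrite !inE !negb_or => /and4P [-> -> -> ->] /= /and3P [/eqP -> /eqP -> impl].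
by rewrite !eqxx /= implyNb orbC -implybE.
Qed.

Lemma spider_compl (G : sgraph) (A : {set G}) thick n g :
  spider_in A thick n g -> @spider_in (compl G) A (~~ thick) n (fun b => g (~~ b)).
Proof.
case=> n_gt1 sp inA; split=> // [b b' i j lt_i lt_j|b i]; last exact: inA.
rewrite compl_edgeE sp //; case: eqP => [/(spider_inj n_gt1 sp lt_i lt_j)|].
  by case=> /negb_inj -> ->; rewrite /spider_edge !addbb eqxx !andbF.
rewrite /spider_edge => neq_g; case: (i =P j) => [eq_ij|neq_ij].
  by case: b b' neq_g => [] [] neq_g //=; try (by case: neq_g; rewrite eq_ij); case: (thick).
by case: b b' {neq_g} => [] [] //=; case: (thick).
Qed.

Lemma spider_p4 (G : sgraph) n (g : bool -> nat -> G) i j :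
  spider (@edge G) false n g -> i < n -> j < n -> i != j ->
  p4 [:: g false i; g true i; g true j; g false j].
Proof.
move=> sp lt_i lt_j neq; rewrite /p4 !sp // /spider_edge /= !eqxx neq.
by rewrite (negbTE neq).
Qed.

(* If [m] sees the clique only and [x] violates the join rules, the spider grows;
   for two legs a vertex seeing everything but [m] gives a thick spider. *)
Lemma thin_spider_head (G : sgraph) (A : {set G}) n g m x :
  no_p4_extension G -> spider_in A false n g ->
  (forall thick n' h, spider_in A thick n' h -> n' <= n) ->
  m \in A -> (forall b i, i < n -> edge m (g b i) = b) ->
  forall c, x \in A -> (forall b i, i < n -> edge x (g b i) = c) ->
  x != m -> edge x m = c.
Proof.
move=> tr [n_gt1 sp inA] max mA eM c xA eX neq_xm; apply: NNPP => /eqP exm.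
have n_gt0 := ltnW n_gt1.
have eM' b i : i < n -> edge (g b i) m = b by rewrite edge_sym; apply: eM.
have eX' b i : i < n -> edge (g b i) x = c by rewrite edge_sym; apply: eX.
case: c eX eX' exm => eX eX' exm.
  have {}exm : edge x m = false by case: (edge x m) exm.
  have emx : edge m x = false by rewrite edge_sym.
  have [n_gt2|n_le2] := ltnP 2 n.
    (* Of the midpoints of this P_4, [g false 2] sees [x] but not [g true 0]: a forbidden trace. *)
    have p4q : p4 [:: m; g true 0; x; g false 1].
      by rewrite /p4 !eM // eX' // eX // emx sp.
    have [|_ /eqP + _] := and3P (tr _ (g false 2) p4q _); last by rewrite sp // eX'.
    rewrite !inE !negb_or; apply/and4P; split; apply/eqP.
    - by move=> eq_m; have := eM true 0 n_gt0; rewrite -eq_m sp.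
    - by case/(spider_inj n_gt1 sp n_gt2 n_gt0).
    - by move=> eq_x; have := eX false 1 n_gt1; rewrite -eq_x sp.
    - by case/(spider_inj n_gt1 sp n_gt2 n_gt1).
  have {n_le2} eq_n : n = 2 by apply/eqP; rewrite eqn_leq n_le2.
  subst n.
  (* The two old legs trade places, since in a thick spider a clique vertex misses exactly the leg
     with its own index. *)
  pose h b i := match i with
    | 0 => if b then g true 0 else g false 1
    | 1 => if b then g true 1 else g false 0
    | _ => if b then x else m end.
  suff /max : spider_in A true 3 h by [].
  split=> // [b b' i j|b i].
    by case: i => [|[|[|]]] // _; case: j => [|[|[|]]] // _; case: b; case: b';
      rewrite /h ?edge_irr ?exm ?emx ?sp ?eM ?eX ?eM' ?eX'.
  by case: i b => [|[|[|]]] // [] _ //=; apply: inA.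
have {}exm : edge x m by case: (edge x m) exm.
have emx : edge m x by rewrite edge_sym.
pose h b i := if i == n then (if b then m else x) else g b i.
suff /max : spider_in A false n.+1 h by rewrite ltnn.
split=> // [b b' i j|b i].
  rewrite !ltnS (leq_eqVlt i) (leq_eqVlt j) /h.
  case: (i =P n) => [-> _|/eqP neq_i /= lt_i]; case: (j =P n) => [->|/eqP neq_j] /= => [_|lt_j].
  + by rewrite /spider_edge eqxx; case: b b' => [] []; rewrite ?edge_irr ?exm ?emx.
  + rewrite /spider_edge eq_sym (negbTE neq_j).
    by case: b b' => [] []; rewrite ?eM ?eX.
  + by rewrite /spider_edge (negbTE neq_i); case: b b' => [] []; rewrite ?eM' ?eX'.
  + exact: sp.
rewrite ltnS leq_eqVlt /h; case: eqP => [_ _|_ /=]; first by case: b.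
exact: inA.
Qed.

(** Any two legs with their clique vertices form a P_4, so an outside vertex sees nothing,
    everything, or exactly the clique. Those of the last kind form the head; maximality of the
    spider makes the others see the head as they see [D]. *)
Lemma thin_spider_module (G : sgraph) (A : {set G}) n g :
  no_p4_extension G -> spider_in A false n g ->
  (forall thick n' h, spider_in A thick n' h -> n' <= n) ->
  body_module (@spider_body G) A.
Proof.
move=> tr spA max; have [n_gt1 sp inA] := spA.
have n_gt0 := ltnW n_gt1.
have neg_p4 i : i < n -> exists2 j, j < n & i != j.
  by case: i => [|i] _; [exists 1|exists 0].
pose D := [set x | [exists b, [exists i : 'I_n, g b i == x]]].
pose K := [set x | [exists i : 'I_n, g true i == x]].
have DP x : reflect (exists b i, i < n /\ g b i = x) (x \in D).
  rewrite inE; apply: (iffP existsP) => [[b /existsP [i /eqP eq_x]]|].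
    by exists b, i.
  by case=> b [i [lt_i eq_x]]; exists b; apply/existsP; exists (Ordinal lt_i); apply/eqP.
have gD b i : i < n -> g b i \in D by move=> lt_i; apply/DP; exists b, i.
have gK b i : i < n -> (g b i \in K) = b.
  move=> lt_i; rewrite inE; apply/existsP/idP => [[j /eqP]|].
    by case/(spider_inj n_gt1 sp (ltn_ord j) lt_i) => <-.
  by case: b => // _; exists (Ordinal lt_i).
have sDA x : x \in D -> x \in A by case/DP => b [i [lt_i <-]]; apply: inA.
have trace x i j : x \notin D -> i < n -> j < n -> i != j ->
    [/\ edge x (g false i) = edge x (g false j), edge x (g true i) = edge x (g true j)
      & edge x (g false i) -> edge x (g true i)].
  move=> xD lt_i lt_j neq_ij.
  have p4q := spider_p4 sp lt_i lt_j neq_ij.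
  have [|/eqP -> /eqP -> /implyP //] := and3P (tr _ x p4q _).
  by apply: contra xD; move: x; apply/allP; rewrite /= !gD.
have trace0 x b i : x \notin D -> i < n -> edge x (g b i) = edge x (g b 0).
  move=> xD lt_i; have [-> //|nz_i] := eqVneq i 0.
  by have [] := trace x i 0 xD lt_i n_gt0 nz_i; case: b.
pose mid x := [&& x \notin D, ~~ edge x (g false 0) & edge x (g true 0)].
pose Z := D :|: [set x in A | mid x].
have midE m b i : mid m -> i < n -> edge m (g b i) = b.
  by case/and3P=> mD m0 m1 lt_i; rewrite trace0 //; case: b => //; apply/negbTE.
have sZA : Z \subset A.
  by apply/subsetP=> x /setUP [/sDA //|/setIdP []].
have outE y z : z \in Z -> y \in A :\: Z -> edge y z = edge y (g true 0).
  move=> zZ; rewrite inE => /andP [yZ yA].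
  have yD : y \notin D by apply: contra yZ => yD; apply/setUP; left.
  have nmid : ~~ mid y by apply: contra yZ => midy; rewrite !inE yA midy orbT.
  have constE b i : i < n -> edge y (g b i) = edge y (g true 0).
    move=> lt_i; rewrite trace0 //; case: b => //.
    have [_ _] := trace y 0 1 yD n_gt0 n_gt1 isT.
    by move: nmid; rewrite /mid yD /=; case: (edge y (g false 0)) => /= [_ -> //|/negbTE ->].
  case/setUP: zZ => [/DP [b [i [lt_i <-]]]|]; first exact: constE.
  rewrite inE => /andP [zA midz].
  apply: (thin_spider_head tr spA max zA (fun b i => midE z b i midz)) => //.
  by apply: contraNneq nmid => ->.
exists D, K, Z; split.
- by apply/set0Pn; exists (g true 0); apply: gD.
- exact: subsetUl.
- exact: sZA.
- have sp4 := p4_uniq (spider_p4 sp n_gt0 n_gt1 isT).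
  apply: leq_trans (_ : #|[:: g false 0; g true 0; g true 1; g false 1]| <= _).
    by rewrite (card_uniqP sp4).
  apply: subset_leq_card; apply: subset_trans (subsetUl _ _).
  by apply/subsetP/allP; rewrite /= !gD.
split.
- move=> x /DP [b [i [lt_i <-]]]; have [j lt_j neq_ij] := neg_p4 i lt_i.
  exists [:: g false i; g true i; g true j; g false j].
  split; first exact: spider_p4 sp _ _ _.
    by case: b; rewrite !inE eqxx ?orbT.
  by apply/allP; rewrite /= !inA.
- by exists false, n, g; split=> // x; split => /DP.
- move=> x y /DP [b [i [lt_i <-]]]; rewrite inE gK // => /andP [/negbTE yD].
  by rewrite inE yD inE => /andP [yA midy]; rewrite edge_sym midE.
- by move=> x x' y xZ x'Z yZ; rewrite !(edge_sym _ y) !outE.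
Qed.

Lemma compl_compl_edge (G : sgraph) (x y : G) : @edge (compl (compl G)) x y = edge x y.
Proof.
rewrite !compl_edgeE; have [->|neq] /= := eqVneq x y; first by rewrite edge_irr.
by rewrite negbK.
Qed.

(** [D] and [Z] stay; the head now sees exactly the old legs, which form the new clique. *)
Lemma body_module_compl (G : sgraph) (A : {set G}) :
  body_module (@spider_body (compl G)) A -> body_module (@spider_body G) A.
Proof.
case=> D [K [Z [nzD sDZ sZA Z_gt2 [covD bodyD splitD modZ]]]].
have neq (B : {set G}) x y : x \in B -> y \in A :\: B -> x != y.
  by rewrite inE => xB /andP [+ _]; apply: contraNneq => <-.
exists D, (~: K), Z; split=> //; split.
- move=> z /covD [q [p4q zq sub]].
  case: q p4q zq sub => [|a [|b [|c [|d []]]]] // /compl_p4 p4q zq sub.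
  exists [:: b; d; a; c]; split=> //.
    by move: zq; rewrite !inE => /or4P [] ->; rewrite ?orbT.
  by move=> u uq; apply: sub; move: uq; rewrite !inE => /or4P [] ->; rewrite ?orbT.
- have [thick [n [g [n_gt1 sp onto gK]]]] := bodyD.
  have /spider_compl [_ sp' _] : @spider_in (compl G) setT thick n g.
    by split=> // b i _; rewrite inE.
  exists (~~ thick), n, (fun b => g (~~ b)); split=> //.
  + by move=> b b' i j lt_i lt_j; rewrite -sp' // compl_compl_edge.
  + move=> x; rewrite onto; split=> -[b [i [lt_i eq_x]]].
      by exists (~~ b), i; rewrite negbK.
    by exists (~~ b), i.
  + by move=> b i lt_i; rewrite in_setC gK // negbK.
- move=> x y xD; rewrite inE => /andP [yD yZ].
  have neq_xy : x != y by apply: contraNneq yD => <-.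
  have := splitD x y xD; rewrite compl_edgeE neq_xy in_setC inE yD yZ => <- //.
  by rewrite negbK.
- move=> x x' y xZ x'Z yZ; have := modZ x x' y xZ x'Z yZ.
  by rewrite !compl_edgeE !(neq Z) // => /negb_inj.
Qed.

Lemma spider_body_module (G : sgraph) (A : {set G}) :
  no_p4_extension G -> has_p4 A -> body_module (@spider_body G) A.
Proof.
move=> tr [[|a [|b [|c [|d []]]]] // p4q sub].
pose sp (s : bool * nat * (bool -> nat -> G)) := spider_in A s.1.1 s.1.2 s.2.
have le_card s : sp s -> s.1.2 <= #|A|.
  case: s => [[thick n] g] [/= n_gt1 spg inA].
  pose f (i : 'I_n) := g true i.
  have f_inj : injective f.
    by move=> i j /(spider_inj n_gt1 spg (ltn_ord i) (ltn_ord j)) [_ /val_inj].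
  rewrite -[n]card_ord -(card_imset _ f_inj); apply: subset_leq_card.
  by apply/subsetP=> _ /imsetP [i _ ->]; apply: inA.
(* A spider with most legs is taken, thin or thick; [le_card] makes the truncated subtraction
   faithful. The given P_4 is a thin spider with two legs. *)
have [|[[thick n] g] spg] := @ex_minimum _ (fun s => #|A| - s.1.2) sp.
  pose g (v : bool) (i : nat) : G :=
    if v then (if i == 0 then b else c) else (if i == 0 then a else d).
  exists (false, 2, g); split=> // [v v' i j|v i].
    move: p4q => /and5P [ab bc cd /negbTE ac /andP [/negbTE bd /negbTE ad]].
    by case: i => [|[|]] //= _; case: j => [|[|]] //= _; case: v v' => [] [];
      rewrite /g /spider_edge /= ?edge_irr // ?ab ?bc ?cd ?ac ?bd ?ad //
        edge_sym ?ab ?bc ?cd ?ac ?bd ?ad.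
  by case: i v => [|[|]] [] //= _; apply: sub; rewrite !inE eqxx ?orbT.
move=> max_g; have {}max_g thick' n' h : spider_in A thick' n' h -> n' <= n.
  move=> sph; have := max_g (thick', n', h) sph.
  by rewrite leq_sub2lE //; apply: (le_card (thick', n', h)).
(* A thick spider is thin in the complement, and maximal there as well. *)
case: thick spg => spg; last exact: thin_spider_module spg max_g.
apply: body_module_compl.
apply: (@thin_spider_module (compl G) A n (fun b => g (~~ b))).
- exact: no_p4_extension_compl.
- exact: spider_compl spg.
move=> thick' n' h /spider_compl [n'_gt1 sph inA].
apply: (max_g (~~ thick') n' (fun b => h (~~ b))); split=> //.
by move=> v v' i j lt_i lt_j; rewrite -sph // compl_compl_edge.
Qed.

Lemma marked_spider_induced (G : sgraph) (D K : {set G}) :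
  spider_body D K -> marked_spider (induced_marked D K).
Proof.
case=> thick [n [g [n_gt1 sp onto gK]]].
have gD b i : i < n -> g b i \in D by move=> lt_i; apply/onto; exists b, i.
pose u0 : induced D := exist (fun x => x \in D) _ (gD true 0 (ltnW n_gt1)).
pose h b i : induced D := insubd u0 (g b i).
have hE b i : i < n -> val (h b i) = g b i.
  by move=> lt_i; rewrite insubdK //; apply: (gD b i).
exists thick, n, h; split=> // [b b' i j lt_i lt_j|x|b i lt_i].
- by rewrite -sp // -!hE.
- have /onto [b [i [lt_i eq_x]]] := valP x.
  by exists b, i; split=> //; apply: val_inj; rewrite hE.
- by rewrite inE hE // gK.
Qed.

(** * P_4-extendible graphs *)

Definition p4_meeting (G : sgraph) (q : seq G) (x : G) : Prop :=
  exists q', [/\ p4 q', x \in q' & has (mem q) q'].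

Definition unique_p4_extension (G : sgraph) : Prop :=
  forall (q : seq G) x y, p4 q -> x \notin q -> y \notin q ->
  p4_meeting q x -> p4_meeting q y -> x = y.

Lemma P4_extendible_unique_p4_extension (G : sgraph) :
  P4_extendible G -> unique_p4_extension G.
Proof.
move=> ext q x y p4q xq yq xmeets ymeets.
have meets z : p4_meeting q z -> in_P4_meeting [set u in q] z.
  case=> q' [p4q' zq' /hasP [u uq' /= uq]]; exists [set v in q']; split.
  - exact: is_P4_p4.
  - by rewrite inE.
  - by apply/set0Pn; exists u; rewrite !inE uq' uq.
by apply: (ext _ (is_P4_p4 p4q)); rewrite ?inE //; apply: meets.
Qed.

(** A permitted trace is symmetric, so its value at [v] is that at the mirror image of [v] in the
    path. *)
Lemma p4_trace_agree (T : eqType) (g g' : T -> bool) (q : seq T) v :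
  uniq q -> p4_trace g q -> p4_trace g' q -> v \in q ->
  (forall u, u \in q -> u != v -> g u = g' u) -> g v = g' v.
Proof.
case: q => [|a [|b [|c [|d []]]]] //.
rewrite /uniq !inE !negb_or andbT.
case/and4P=> /and3P [ab ac ad] /andP [bc bd] cd _ /and3P [/eqP gad /eqP gbc _].
case/and3P=> /eqP gad' /eqP gbc' _ vq agree.
case/or4P: vq => /eqP eq_v; subst v.
- by rewrite gad gad' agree ?inE ?eqxx ?orbT // eq_sym.
- by rewrite gbc gbc' agree ?inE ?eqxx ?orbT // eq_sym.
- by rewrite -gbc -gbc' agree ?inE ?eqxx ?orbT.
- by rewrite -gad -gad' agree ?inE ?eqxx ?orbT.
Qed.

(* [D] consists of [q] and of the vertex, if any, of a further P_4 meeting [q]. *)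
Lemma p4_closure (G : sgraph) (A : {set G}) (q : seq G) :
  unique_p4_extension G -> p4 q -> {subset q <= A} ->
  exists D : {set G}, [/\ {subset q <= D}, D \subset A, #|D| <= 5, covered A D &
    (forall q' : seq G, p4 q' -> {subset q' <= A} -> has (mem D) q' -> {subset q' <= D}) /\
    (forall g g' : G -> bool,
       (forall q' : seq G, p4 q' -> {subset q' <= D} -> p4_trace g q' /\ p4_trace g' q') ->
       {in q, g =1 g'} -> {in D, g =1 g'})].
Proof.
move=> ext p4q sqA.
have size_q : size q = 4 by case: q p4q {sqA} => [|a [|b [|c [|d []]]]].
have cardq : #|[set x in q]| = 4.
  by rewrite cardsE (card_uniqP (p4_uniq p4q)) size_q.
have [[v [vA vq [q1 [p4q1 sq1A vq1 meet1]]]]|no_ext] := classic (exists v,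
  [/\ v \in A, v \notin q & exists q1, [/\ p4 q1, {subset q1 <= A}, v \in q1 & has (mem q) q1]]);
  last first.
  exists [set x in q]; split.
  - by move=> x xq; rewrite inE.
  - by apply/subsetP=> x; rewrite inE => /sqA.
  - by rewrite cardq.
  - by move=> z; rewrite inE => zq; exists q.
  split=> [q' p4q' sq'A meet' x xq'|g g' _ eq_q x]; last by rewrite inE; apply: eq_q.
  rewrite inE; apply: contra_notT no_ext => xq; exists x; split=> //; first exact: sq'A.
  by exists q'; split=> //; apply: sub_has meet' => y /=; rewrite inE.
have sq1 x : x \in q1 -> x = v \/ x \in q.
  move=> xq1; have [|xq] := boolP (x \in q); [by right|left].
  by apply: (ext q) => //; exists q1.
(* [w] is the vertex of [q] that [v] replaces in [q1]. *)
have [w wq wq1] : exists2 w, w \in q & w \notin q1.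
  apply/hasP; rewrite has_predC; apply: contra vq => /allP sub.
  by rewrite (uniq_min_size (p4_uniq p4q) sub _).2 //;
    case: (q1) p4q1 size_q => [|? [|? [|? [|? []]]]] //= _ ->.
pose D := v |: [set x in q].
have qD x : x \in q -> x \in D by move=> xq; rewrite !inE xq orbT.
have q1D x : x \in q1 -> x \in D by case/sq1 => [->|/qD //]; rewrite !inE eqxx.
exists D; split=> //.
- by apply/subsetP=> x; rewrite !inE => /predU1P [->|/sqA].
- by rewrite cardsU1 cardq inE vq.
- move=> z; rewrite !inE => /predU1P [->|zq]; [by exists q1|by exists q].
(* If [q'] meets [q], uniqueness for [q] gives [x = v]. Otherwise [q'] meets [q1] in [v], and
   uniqueness for [q1] gives [x = w]. Both are absurd. *)
split=> [q' p4q' sq'A meet' x xq'|g g' tr eq_q x].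
  have [//|xD] := boolP (x \in D).
  have xq : x \notin q by apply: contra xD; apply: qD.
  have xq1 : x \notin q1 by apply: contra xD; apply: q1D.
  have [meetq|nmeet] := boolP (has (mem q) q').
    have eq_xv : x = v by apply: (ext q) => //; [exists q'|exists q1].
    by rewrite eq_xv !inE eqxx in xD.
  have vq' : v \in q'.
    have /hasP [y yq'] := meet'; rewrite /= !inE => /predU1P [<- //|yq].
    by case/hasP: nmeet; exists y.
  have eq_xw : x = w.
    apply: (ext q1) => //; first by exists q'; split=> //; apply/hasP; exists v.
    exists q; split=> //; have /hasP [y yq1 /= yq] := meet1.
    by apply/hasP; exists y.
  by rewrite eq_xw wq in xq.
rewrite !inE => /predU1P [->|]; last exact: eq_q.
have [tr1 tr1'] := tr q1 p4q1 q1D.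
apply: (p4_trace_agree (p4_uniq p4q1) tr1 tr1' vq1) => u /sq1 [->|uq]; first by rewrite eqxx.
by move=> _; apply: eq_q.
Qed.

(** No P_4 of [A] crosses the border of [D], so an outside vertex has a permitted trace on every P_4
    inside [D], and its neighbours in [D] are determined by those in [q]. The vertices seeing just
    the midpoints of [q] form the head. *)
Lemma small_body_module (G : sgraph) (A : {set G}) :
  unique_p4_extension G -> has_p4 A -> body_module (fun D _ => #|D| <= 5) A.
Proof.
move=> ext [q p4q sqA].
have [D [qD sDA cardD covD [closed rigid]]] := p4_closure ext p4q sqA.
have no_cross (q' : seq G) x y : p4 q' -> {subset q' <= A} -> x \in q' -> x \in D ->
    y \in q' -> y \in D.
  by move=> p4q' sq'A xq' xD; apply: closed => //; apply/hasP; exists x.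
have trace x (q' : seq G) : x \in A -> x \notin D -> p4 q' -> {subset q' <= D} ->
    p4_trace (edge x) q'.
  move=> xA xD p4q' sq'D; apply/negPn/negP.
  have xq' : x \notin q' by apply: contra xD; apply: sq'D.
  case/(p4_extension p4q' xq') => q2 [p4q2 xq2 /hasP [y yq2 /sq'D yD] sq2].
  case/negP: xD; apply: (no_cross q2 y) => // z /sq2.
  by rewrite inE => /predU1P [->|/sq'D] //; apply: (subsetP sDA).
have agree x (g : G -> bool) : x \in A -> x \notin D ->
    (forall q' : seq G, p4 q' -> {subset q' <= D} -> p4_trace g q') ->
    {in q, edge x =1 g} -> {in D, edge x =1 g}.
  by move=> xA xD tr; apply: rigid => q' p4q' sq'D; split; [apply: trace|apply: tr].
have size_q : size q = 4 by case: q p4q {sqA qD rigid agree} => [|a [|b [|c [|d []]]]].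
have q_uniq := p4_uniq p4q.
case: q p4q qD sqA agree size_q q_uniq {rigid} =>
  [|a [|b [|c [|d []]]]] // p4q qD sqA agree _ q_uniq.
have [aD bD cD dD] : [/\ a \in D, b \in D, c \in D & d \in D].
  by split; apply: qD; rewrite !inE eqxx ?orbT.
have /and5P [ab bc cd nac /andP [nbd nad]] := p4q.
pose mid x := ~~ edge x a && edge x b.
pose M := [set x in A :\: D | mid x].
pose Z := D :|: M.
have sZA : Z \subset A by rewrite subUset sDA; apply/subsetP=> x; rewrite !inE => /andP [/andP []].
have MP x : x \in M -> [/\ x \in A, x \notin D &
    [/\ edge x a = false, edge x b, edge x c & edge x d = false]].
  rewrite !inE => /andP [/andP [xD xA] /andP [nxa xb]]; split=> //.
  have /and3P [/eqP xad /eqP xbc _] := trace x _ xA xD p4q qD.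
  by rewrite -xad -xbc xb (negbTE nxa).
(* Such an [x] sees none or all of [q]. A constant function has permitted traces, so [agree] extends
   this to [D]. *)
have constE x : x \in A -> x \notin Z -> {in D, forall u, edge x u = edge x a}.
  move=> xA; rewrite !inE negb_or => /andP [xD]; rewrite xA xD /= => nmid.
  apply: (agree x (fun=> edge x a)) => // [[|? [|? [|? [|? []]]]] //|u uq].
    by rewrite /= eqxx implybb.
  have /and3P [/eqP xad /eqP xbc /implyP xab] := trace x _ xA xD p4q qD.
  have xba : edge x b = edge x a.
    by move: nmid xab; rewrite /mid; case: (edge x a) (edge x b) => [] [] //= _ /(_ isT).
  by move: uq; rewrite !inE => /or4P [] /eqP -> //; rewrite -?xbc -?xad.
(* Otherwise [m], [x] and two vertices of [q] form a P_4 crossing the border of [D]. *)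
have joinE x m : x \in A -> x \notin Z -> m \in M -> edge x m = edge x a.
  move=> xA xZ mM; have [mA mD [nma mb mc nmd]] := MP m mM.
  have xD : x \notin D by apply: contra xZ => xD; rewrite inE xD.
  apply: NNPP => /eqP neq.
  have [xa|nxa] := boolP (edge x a).
    have nxm : edge x m = false by case: (edge x m) neq; rewrite ?xa.
    case/negP: mD; apply: (no_cross [:: m; b; x; d] b); rewrite ?inE ?eqxx ?orbT //.
      rewrite /= mb (edge_sym b x) (edge_sym m x) nxm nbd nmd.
      by rewrite (constE x xA xZ b bD) (constE x xA xZ d dD) xa.
    by apply/allP; rewrite /= mA xA !(subsetP sDA).
  have xm : edge x m by case: (edge x m) neq; rewrite ?(negbTE nxa).
  case/negP: mD; apply: (no_cross [:: x; m; b; a] b); rewrite ?inE ?eqxx ?orbT //.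
    by rewrite /= xm mb (edge_sym b a) ab nma (constE x xA xZ b bD) nxa.
  by apply/allP; rewrite /= mA xA !(subsetP sDA).
(* All members of [M] agree on [q], hence on [D], so any of them can define [K]; for empty [M] the
   head is empty. *)
pose K := if [pick m in M] is Some m then [set u | edge m u] else set0.
have splitM m u : m \in M -> u \in D -> edge m u = (u \in K).
  rewrite /K; case: pickP => [m0 m0M mM|no_m]; last by move=> mM; have := no_m m; rewrite mM.
  have [mA mD [ma mb mc md]] := MP m mM; have [m0A m0D [m0a m0b m0c m0d]] := MP m0 m0M.
  rewrite inE; apply: agree => // [q' p4q' sq'D|z]; first exact: trace.
  by rewrite !inE => /or4P [] /eqP ->; rewrite ?ma ?mb ?mc ?md.
have outE x z : x \in A -> x \notin Z -> z \in Z -> edge x z = edge x a.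
  by move=> xA xZ /setUP [zD|zM]; [apply: constE|apply: joinE].
exists D, K, Z; split=> //.
- by apply/set0Pn; exists a.
- exact: subsetUl.
- have cardq : #|[:: a; b; c; d]| = 4 by rewrite (card_uniqP q_uniq).
  apply: leq_trans (_ : #|[:: a; b; c; d]| <= _); first by rewrite cardq.
  apply: subset_leq_card; apply: subset_trans (subsetUl _ _).
  by apply/subsetP=> z /qD.
split=> //.
- move=> x y xD; rewrite inE => /andP [/negbTE yD /setUP [|yM]]; first by rewrite yD.
  by rewrite edge_sym splitM.
- move=> x x' y xZ x'Z /setDP [yA yZ].
  by rewrite !(edge_sym _ y) !outE.
Qed.

(** * Finiteness of the obstructions *)

Lemma wqo_P4_extendible_or_sparse (C : sgraph -> Prop) :
  (forall G, C G -> P4_extendible G) \/ (forall G, C G -> P4_sparse G) ->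
  induced_closed C -> wqo embed C.
Proof.
move=> C_sub C_induced.
apply: (wqo_embed_body C_induced (wqo_union (@wqo_bounded_size 5) wqo_spider)).
move=> G CG nzG.
have cardD (D K : {set G}) : #|tag (induced_marked D K)| = #|D| by rewrite /= card_sig.
have [G_gt1|G_le1] := ltnP 1 #|[set: G]|; last first.
  (* A single vertex is its own body, of size at most five. *)
  exists setT, set0; split=> [|x y _|]; rewrite ?inE //.
    by rewrite -card_gt0 cardsT.
  by right; left; rewrite cardD (leq_trans G_le1).
have split_setT (D K : {set G}) : body_split_in setT D K -> body_split D K.
  by move=> splitD x y xD yD; apply: splitD; rewrite // !inE yD.
have of_const : (exists D b, const_split [set: G] D b) -> exists D K : {set G},
     [/\ D != set0, body_split D K &
         D != setT /\ (K = set0 \/ K = setT) \/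
         (#|tag (induced_marked D K)| <= 5 \/ marked_spider (induced_marked D K))].
  case=> D [b [nzD ltD eD]]; exists D, (if b then setT else set0); split=> //.
    by apply: split_setT => x y xD yD; rewrite eD //; case: (b); rewrite inE.
  by left; split; [rewrite -properT | case: (b); [right|left]].
case: C_sub => [/(_ G CG)/P4_extendible_unique_p4_extension ext|
  /(_ G CG)/P4_sparse_no_p4_extension tr].
  have no_twins (q : seq G) x y : p4 q -> x \notin q -> y \notin q -> x != y ->
      p4_trace (edge x) q \/ p4_trace (edge y) q.
    move=> p4q xq yq neq_xy.
    have [|trx] := boolP (p4_trace (edge x) q); [by left|right].
    apply: contraNT neq_xy => try; apply/eqP; apply: (ext q) => //.
      by have [q' [? ? ? _]] := p4_extension p4q xq trx; exists q'.
    by have [q' [? ? ? _]] := p4_extension p4q yq try; exists q'.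
  have [|[D [K [nzD _ _ D5 splitD]]]] :=
    split_or_body no_twins (fun A => small_body_module ext) G_gt1; first exact: of_const.
  by exists D, K; split; rewrite ?cardD; auto.
have no_twins (q : seq G) x y : p4 q -> x \notin q -> y \notin q -> x != y ->
    p4_trace (edge x) q \/ p4_trace (edge y) q by left; apply: tr.
have [|[D [K [nzD _ _ spD splitD]]]] :=
  split_or_body no_twins (fun A => spider_body_module tr) G_gt1; first exact: of_const.
by exists D, K; split; auto; right; right; apply: marked_spider_induced.
Qed.

(** Greedy choice: no finite list represents all of [C], so each can be extended by a graph that is
    new up to isomorphism. *)
Lemma finite_or_sequence (C : sgraph -> Prop) :
  ~ finite_up_to_iso C -> exists f : nat -> sgraph,
  (forall i, C (f i)) /\ (forall i j, i < j -> ~ iso (f j) (f i)).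
Proof.
move=> infC.
have /functional_choice [new new_prop] : forall s : seq sgraph, exists G,
    C G /\ forall i, i < size s -> ~ iso G (nth G s i).
  move=> s; apply: NNPP => no_new; apply: infC.
  exists (size s), (fun i => nth (path_graph 4) s i) => G CG.
  apply: NNPP => no_i; apply: no_new; exists G; split=> // i lt_i isoG.
  by apply: no_i; exists (Ordinal lt_i); rewrite /= (set_nth_default G).
pose s := fix s n := if n is m.+1 then rcons (s m) (new (s m)) else [::].
have size_s n : size (s n) = n by elim: n => //= n IHn; rewrite size_rcons IHn.
have nth_s G i n : i < n -> nth G (s n) i = new (s i).
  elim: n => //= n IHn; rewrite ltnS leq_eqVlt nth_rcons size_s => /predU1P [->|lt_in].
    by rewrite ltnn eqxx.
  by rewrite lt_in IHn.
exists (fun n => new (s n)); split=> [i|i j lt_ij isoij]; first by case: (new_prop (s i)).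
have [_ /(_ i)] := new_prop (s j); rewrite size_s => /(_ lt_ij); apply.
by rewrite nth_s.
Qed.

Lemma iso_sym (G H : sgraph) : iso G H -> iso H G.
Proof.
case=> f [g fK gK] f_edge; exists g; first by exists f.
by move=> x y; rewrite -f_edge !gK.
Qed.

Lemma iso_induced_imset (G H : sgraph) (f : G -> H) :
  injective f -> (forall x y, edge (f x) (f y) = edge x y) ->
  iso G (induced (f @: setT)).
Proof.
move=> f_inj f_edge.
pose g x : induced (f @: setT) := exist (fun y => y \in f @: setT) (f x) (imset_f f (in_setT x)).
exists g => //; apply: inj_card_bij => [x y /(congr1 val) /f_inj //|].
by rewrite card_sig card_imset // cardsT.
Qed.

Theorem theorem56 (C : sgraph -> Prop)
  (C_iso : iso_closed C)
  (C_sub : (forall G : sgraph, C G -> P4_extendible G) \/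
           (forall G : sgraph, C G -> P4_sparse G))
  (C_compl : compl_closed C)
  (C_induced : induced_closed C)
  (P : sgraph -> Prop)
  (P_iso : iso_closed P)
  (P_hereditary : hereditary_on C P) :
  finite_up_to_iso (fun G => C G /\ minimal_obstruction P G).
Proof.
apply: NNPP => /finite_or_sequence [f [obs_f noniso]].
have [i [j [lt_ij [h h_inj h_edge]]]] :=
  wqo_P4_extendible_or_sparse C_sub C_induced (fun i => proj1 (obs_f i)).
have [_ [notP _]] := obs_f i; have [_ [_ minP]] := obs_f j.
have iso_h := iso_induced_imset h_inj h_edge.
(* An onto embedding contradicts [noniso]; otherwise [f i] is a copy of a proper induced subgraph of
   the obstruction [f j] and so has [P]. *)
have [onto|/negP not_onto] := boolP (h @: setT == setT).
  apply: (noniso i j lt_ij); apply: iso_sym; exists h => //.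
  by apply: inj_card_bij => //; rewrite -cardsT -(eqP onto) card_imset // cardsT.
apply: notP; apply: P_iso (iso_sym iso_h) _; apply: minP.
by rewrite properT; apply/negP.
Qed.
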